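(* Let $R$ be a ring and $M$ a right $R$-module. The following are equivalent: (i) $M$ is ADS. (ii) For any direct summand $S_1$ of $M$ and any submodule $S_2$ of $M$ with $S_1\cap S_2=0$, each projection map $\pi_i:S_1\oplus S_2\to S_i$ ($i=1,2$) can be extended to an endomorphism (indeed a projection, i.e. an idempotent endomorphism) of $M$. (iii) If $M=M_1\oplus M_2$, then $M_1$ and $M_2$ are mutually injective. (iv) For any decomposition $M=A\oplus B$, the projection $\pi_B:M\to B$ (along $A$) restricts to an isomorphism $C\to B$ for every complement $C$ of $A$ in $M$. (v) For any decomposition $M=A\oplus B$ and any $b\in B$, $A$ is $bR$-injective. (vi) For any direct summand $A$ of $M$ and any $c\in M$ such that $A\cap cR=0$, $A$ is $cR$-injective.
   Context: All rings are associative with identity and all modules are unital right modules. For a submodule $S$ of $M$, a complement of $S$ in $M$ is a submodule of $M$ maximal with respect to having zero intersection with $S$. A module $M$ is called ADS if for every decomposition $M=S\oplus T$ and every complement $T'$ of $S$ in $M$ we have $M=S\oplus T'$. For modules $A,B$, $A$ is $B$-injective if every homomorphism from a submodule of $B$ to $A$ extends to a homomorphism $B\to A$; $A$ and $B$ are mutually injective if $A$ is $B$-injective and $B$ is $A$-injective. *)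

(* Defs.v *)
From HB Require Import structures.
From mathcomp Require Import all_boot all_algebra.
From mathcomp Require Import boolp classical_sets.

Set Implicit Arguments.
Unset Strict Implicit.
Unset Printing Implicit Defensive.

Import GRing.Theory.
Local Open Scope ring_scope.

(* A right R-module is a left module over the converse ring [R^c]: for         *)
(* [r : R^c], the vector [r *: x] is the product x r.                          *)
(*   A submodule of M is a term of MathComp's type [submodClosed M]. It is     *)
(* carried by a boolean predicate, but [boolp] decides all propositions        *)
(* (through [`[< P >]]), so these are all the submodules of M.                 *)

Section Submodules.
Variables (R : pzRingType) (M : lmodType R^c).
Implicit Types S T C D : submodClosed M.

(* The submodule S as a module in its own right; [val] is the inclusion.       *)
Definition submodT S : Type := {x : M | x \in S}.
HB.instance Definition _ S := SubChoice.on (submodT S).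
HB.instance Definition _ S := [SubChoice_isSubLmodule of submodT S by <:].

Definition submod_add S T : {pred M} :=
  [pred x | `[< exists2 s, s \in S & exists2 t, t \in T & x = s + t >]].

Fact submod_add_closed S T : submod_closed (submod_add S T).
Proof.
split; first by apply/asboolP; exists 0; rewrite ?rpred0//;
  exists 0; rewrite ?rpred0 ?addr0.
move=> a x y /asboolP[s sS [t tT ->]] /asboolP[s' s'S [t' t'T ->]].
apply/asboolP; exists (a *: s + s'); first by rewrite rpredD ?rpredZ.
by exists (a *: t + t'); [rewrite rpredD ?rpredZ | rewrite scalerDr addrACA].
Qed.
HB.instance Definition _ S T :=
  GRing.isSubmodClosed.Build R^c M (submod_add S T) (submod_add_closed S T).

(* cR                                                                          *)
Definition cyclic_submod (c : M) : {pred M} :=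
  [pred x | `[< exists r : R^c, x = r *: c >]].

Fact cyclic_submod_closed c : submod_closed (cyclic_submod c).
Proof.
split; first by apply/asboolP; exists 0; rewrite scale0r.
move=> a x y /asboolP[r ->] /asboolP[s ->].
by apply/asboolP; exists (a * r + s); rewrite scalerDl scalerA.
Qed.
HB.instance Definition _ c :=
  GRing.isSubmodClosed.Build R^c M (cyclic_submod c) (cyclic_submod_closed c).

Definition trivial_meet S T : Prop :=
  forall x, x \in S -> x \in T -> x = 0.

Definition decomposition S T : Prop :=
  trivial_meet S T /\ (forall x, x \in submod_add S T).

Definition direct_summand S : Prop := exists T, decomposition S T.

Definition complement S C : Prop :=
  trivial_meet C S /\
  forall D, trivial_meet D S -> {subset C <= D} -> {subset D <= C}.

Definition ADS : Prop :=
  forall S T T', decomposition S T -> complement S T' -> decomposition S T'.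

(* The projection of S (+) T onto S along T, as a function with junk values    *)
(* outside S + T; it is meaningful when [trivial_meet S T] (see [dprojE]).     *)
Definition dproj S T (x : M) : M :=
  xget 0 [set s | s \in S /\ exists2 t, t \in T & x = s + t].

Lemma dprojE S T s t :
  trivial_meet S T -> s \in S -> t \in T -> dproj S T (s + t) = s.
Proof.
move=> ST0 sS tT; rewrite /dproj.
have memB (U : submodClosed M) x y : x \in U -> y \in U -> x - y \in U.
  by move=> xU yU; rewrite -scaleN1r rpredD ?rpredZ.
case: xgetP => [s' _ [s'S [t' t'T e]]|/(_ s) []]; last by split=> //; exists t.
apply/eqP; rewrite -subr_eq0; apply/eqP/ST0; first exact: memB.
suff -> : s' - s = t - t' by exact: memB.
by apply/eqP; rewrite subr_eq addrAC eq_sym subr_eq addrC e addrC.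
Qed.

End Submodules.

Section Injectivity.
Variable R : pzRingType.

Definition relatively_injective (A B : lmodType R^c) : Prop :=
  forall (X : submodClosed B) (f : {linear submodT X -> A}),
    exists g : {linear B -> A}, forall x, g (val x) = f x.

Definition mutually_injective (A B : lmodType R^c) : Prop :=
  relatively_injective A B /\ relatively_injective B A.

End Injectivity.

(* Main.v *)
Require Import Defs.
From HB Require Import structures.
From mathcomp Require Import all_boot all_algebra.
From mathcomp Require Import boolp classical_sets.

Set Implicit Arguments.
Unset Strict Implicit.
Unset Printing Implicit Defensive.

Import GRing.Theory.
Local Open Scope ring_scope.

(** Every condition is compared with the ADS property (i).

    From ADS to the rest. By Zorn's lemma a submodule N that meets the summand
    S trivially lies in a complement C of S, and ADS makes C a direct
    complement, M = S (+) C ([ADS_complement]). The projections of S (+) C are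
    idempotent endomorphisms of M extending those of S (+) N, which is (ii).
    If f is a homomorphism from a submodule X of N to S, the graph
    {x - f x | x in X} meets S trivially; taking C to contain it, the projection
    onto S along C sends x = f x + (x - f x) to f x, so its restriction to N
    extends f ([ADS_relatively_injective]). This gives (iii), (v) and (vi) at
    once. For (iv), two direct complements B and C of A are isomorphic by the
    projections along A.

    From the rest to ADS. Let M = S (+) T and let C be a complement of S; one
    has to see that S + C is all of M, and for that it is enough that S + C
    contains T.
    - Under (ii), extend the projection of S (+) C onto S to f and compose it
      with the projection p onto S along T. The kernel of p o f contains C and
      meets S trivially, so it is C by maximality, and
      x = p (f x) + (x - p (f x)).
    - Under (iii), (v) or (vi), each t in T lies in some N for which S is
      N-injective. Extend to g : N -> S the projection onto S, defined on the
      part of N inside S (+) C. Then u = t - g t generates a submodule whose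
      sum with C still meets S trivially, so u is in C by maximality and
      t = g t + u is in S + C ([relatively_injective_ADS]). One takes N = T
      for (iii) and N = tR for (v) and (vi).
    - Under (iv), t is the projection of some c in C, and c - t is in S. *)

(** * Submodules and projections *)

Section Submodules.
Variables (R : pzRingType) (M : lmodType R^c).
Implicit Types (A B C D S T X : submodClosed M).

Lemma submodB S x y : x \in S -> y \in S -> x - y \in S.
Proof. by move=> xS yS; rewrite -scaleN1r rpredD ?rpredZ. Qed.

Lemma val_submodT S (x : submodT S) : val x \in S.
Proof. exact: valP. Qed.

(** The submodules and linear maps used below depend on hypotheses local to a
    proof; this lemma and the next bundle them there. *)
Lemma submod_ex (P : M -> Prop) :
  P 0 -> (forall a x y, P x -> P y -> P (a *: x + y)) ->
  exists D : submodClosed M, forall x, x \in D <-> P x.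
Proof.
move=> P0 Plin; pose p : {pred M} := [pred x | `[< P x >]].
have pcl : submod_closed p.
  split=> [|a x y /asboolP Px /asboolP Py]; first exact/asboolP.
  by apply/asboolP/Plin.
pose pM := GRing.isSubmodClosed.Build R^c M p pcl.
pose D : submodClosed M := HB.pack p pM.
by exists D => x; split=> [/asboolP | ?]; last exact/asboolP.
Qed.

Lemma linear_ex (U V : lmodType R^c) (f : U -> V) :
  linear f -> exists g : {linear U -> V}, g =1 f.
Proof.
move=> flin; pose fM := GRing.isLinear.Build R^c U V _ f flin.
by pose g : {linear U -> V} := HB.pack f fM; exists g.
Qed.

End Submodules.

Section Decompositions.
Variables (R : pzRingType) (M : lmodType R^c).
Implicit Types (A B C D N S T X : submodClosed M).

Lemma submod_addP S T x :
  x \in submod_add S T <-> exists2 s, s \in S & exists2 t, t \in T & x = s + t.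
Proof. by split=> /asboolP. Qed.

Lemma mem_submod_add S T s t :
  s \in S -> t \in T -> s + t \in submod_add S T.
Proof. by move=> sS tT; apply/submod_addP; exists s => //; exists t. Qed.

Lemma cyclic_submod_gen (c : M) : c \in cyclic_submod c.
Proof. by apply/asboolP; exists 1; rewrite scale1r. Qed.

Lemma trivial_meetC S T : trivial_meet S T -> trivial_meet T S.
Proof. by move=> ST x xT xS; apply: ST. Qed.

Lemma decompositionC S T : decomposition S T -> decomposition T S.
Proof.
case=> ST0 ST; split=> [|x]; first exact: trivial_meetC.
have /submod_addP[s sS [t tT ->]] := ST x.
by rewrite addrC; apply: mem_submod_add.
Qed.

Lemma dproj_l S T s : trivial_meet S T -> s \in S -> dproj S T s = s.
Proof.
by move=> ST sS; rewrite -[s in LHS]addr0; apply: dprojE; rewrite ?rpred0.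
Qed.

Lemma dproj_r S T t : trivial_meet S T -> t \in T -> dproj S T t = 0.
Proof.
by move=> ST tT; rewrite -[t in LHS]add0r; apply: dprojE; rewrite ?rpred0.
Qed.

(** The partial projection [dproj S T] becomes linear once precomposed with a
    linear map landing in S + T; the source V serves both for M itself and for
    its submodules. *)
Lemma dproj_ex (V : lmodType R^c) (h : {linear V -> M}) S T :
  trivial_meet S T -> (forall v, h v \in submod_add S T) ->
  exists q : {linear V -> submodT S}, forall v, val (q v) = dproj S T (h v).
Proof.
move=> ST hST.
have dS v : dproj S T (h v) \in S.
  by have /submod_addP[s sS [t tT ->]] := hST v; rewrite dprojE.
pose q v : submodT S := Sub (dproj S T (h v)) (dS v).
have [|q' q'E] := @linear_ex R V (submodT S) q.
  move=> a u v; apply: val_inj; rewrite !linearP/= linearP.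
  have /submod_addP[s sS [t tT ->]] := hST u.
  have /submod_addP[s' s'S [t' t'T ->]] := hST v.
  by rewrite scalerDr addrACA !dprojE// rpredD// rpredZ.
by exists q' => v; rewrite q'E.
Qed.

Lemma decomposition_proj S T : decomposition S T ->
  exists2 f : {linear M -> M}, idempotent_fun f & f =1 dproj S T.
Proof.
case=> ST0 ST; have [q qE] := dproj_ex (h := idfun) ST0 ST.
have [|f fE] := @linear_ex R M M (fun x => val (q x)).
  by move=> a x y; rewrite !linearP.
exists f => x; last by rewrite fE qE.
by rewrite /= !fE qE dproj_l// val_submodT.
Qed.

End Decompositions.

Section ADS.
Variables (R : pzRingType) (M : lmodType R^c).
Implicit Types (A B C D N S T X : submodClosed M).

(** * Consequences of ADS *)

(** Zorn's lemma on the submodules that contain X and meet A trivially. *)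
Lemma exists_complement A X : trivial_meet X A ->
  exists2 C, complement A C & {subset X <= C}.
Proof.
move=> XA; pose P D := trivial_meet D A /\ {subset X <= D}.
pose le (u v : {D | P D}) := `[< {subset sval u <= sval v} >].
have t0 : {D | P D} by exists X; split.
have le_refl u : le u u by exact/asboolP.
have le_trans u v w : le u v -> le v w -> le u w.
  by move=> /asboolP uv /asboolP vw; apply/asboolP => x /uv/vw.
have ub (F : set {D | P D}) : total_on F le ->
    exists t, forall s, F s -> le s t.
  move=> Ftot; have [[u0 Fu0]|F0] := pselect (exists u, F u); last first.
    by exists t0 => s Fs; case: F0; exists s.
  have [||D DE] := @submod_ex R M (fun x => exists2 u, F u & x \in sval u).
  - by exists u0 => //; rewrite rpred0.
  - move=> a x y [u Fu xu] [v Fv yv].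
    case: (Ftot u v Fu Fv) => /asboolP uv.
      by exists v => //; rewrite rpredD ?rpredZ//; apply: uv.
    by exists u => //; rewrite rpredD ?rpredZ//; apply: uv.
  have PD : P D.
    split=> [x /DE[u _ xu] xA|x xX]; first by case: (svalP u) => + _; apply.
    by apply/DE; exists u0 => //; case: (svalP u0) => _; apply.
  by exists (exist P D PD) => s Fs; apply/asboolP => x xs /=; apply/DE; exists s.
have [[C [CA XC]] Cmax] := ZL_preorder t0 le_refl le_trans ub.
exists C => //; split=> // D DA CD.
have PD : P D by split=> // x /XC/CD.
by apply/asboolP/(Cmax (exist P D PD))/asboolP.
Qed.

(** The form in which ADS is used: direct complements of a summand can be
    chosen to contain any given submodule that meets it trivially. *)
Lemma ADS_complement S N : ADS M -> direct_summand S -> trivial_meet S N ->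
  exists2 C, decomposition S C & {subset N <= C}.
Proof.
move=> ads [T ST] /trivial_meetC/exists_complement[C SC NC].
by exists C => //; apply: ads ST SC.
Qed.

Lemma ADS_extend_dproj S N : ADS M -> direct_summand S -> trivial_meet S N ->
  (exists2 f : {linear M -> M},
     idempotent_fun f & {in submod_add S N, f =1 dproj S N}) /\
  (exists2 f : {linear M -> M},
     idempotent_fun f & {in submod_add S N, f =1 dproj N S}).
Proof.
move=> ads dS SN; have [C SC NC] := ADS_complement ads dS SN.
have CS := decompositionC SC.
have [f fid fE] := decomposition_proj SC.
have [g gid gE] := decomposition_proj CS.
split; [exists f => // | exists g => //].
  move=> _ /submod_addP[s sS [n nN ->]].
  by rewrite fE !dprojE//; [case: SC | apply: NC].
move=> _ /submod_addP[s sS [n nN ->]].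
rewrite gE addrC !dprojE//; [exact: trivial_meetC| by case: CS | exact: NC].
Qed.

(** A homomorphism into A is recovered from the projection along a complement
    of A containing its graph. *)
Lemma ADS_relatively_injective A N :
  ADS M -> direct_summand A -> trivial_meet A N ->
  relatively_injective (submodT A) (submodT N).
Proof.
move=> ads dA AN X f.
(* The graph G of f, as the image of h. *)
pose h (x : submodT X) : M := val (val x) - val (f x).
have hlin : linear h.
  by move=> a x y; rewrite /h !linearP/= scalerDr addrACA.
have [||G GE] := @submod_ex R M (fun y => exists x, y = h x).
- by exists 0; rewrite /h !raddf0 addr0.
- by move=> a _ _ [x ->] [y ->]; exists (a *: x + y); rewrite hlin.
have AG : trivial_meet A G.
  move=> y yA /GE[x yE]; rewrite {y}yE in yA *; have xA : val (val x) \in A.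
    by rewrite -[val (val x)](subrK (val (f x))) rpredD// val_submodT.
  have x0 : x = 0 by apply/val_inj/val_inj/AN => //; rewrite val_submodT.
  by rewrite x0 /h !raddf0 addr0.
have [C [AC0 AC] GC] := ADS_complement ads dA AG.
have [|i iE] := @linear_ex R (submodT N) M val.
  by move=> a x y; rewrite linearP.
have [g gE] := dproj_ex (h := i) AC0 (fun v => AC (i v)).
exists g => x; apply: val_inj; rewrite gE iE.
have -> : val (val x) = val (f x) + h x by rewrite addrC subrK.
by rewrite dprojE ?val_submodT//; apply/GC/GE; exists x.
Qed.

(** Here C is a direct complement of A like B, and the inverse of the
    projection onto B along A is the projection onto C along A. *)
Lemma ADS_complement_iso A B C : ADS M -> decomposition A B ->
  complement A C ->
  exists2 f : {linear submodT C -> submodT B},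
    bijective f & forall c, val (f c) = dproj B A (val c).
Proof.
move=> ads AB cC; have AC := ads _ _ _ AB cC.
have {cC AC} [CA0 CA] := decompositionC AC.
have {AB} [BA0 BA] := decompositionC AB.
have incl S : exists i : {linear submodT S -> M}, i =1 val.
  by apply: linear_ex => a x y; rewrite linearP.
have [[i iE] [j jE]] := (incl C, incl B).
have [f fE] := dproj_ex (h := i) BA0 (fun v => BA _).
have [g gE] := dproj_ex (h := j) CA0 (fun v => CA _).
have projK S T x : trivial_meet S A -> trivial_meet T A ->
    x \in S -> x \in submod_add T A -> dproj S A (dproj T A x) = x.
  move=> SA TA xS /submod_addP[t tT [a aA xE]].
  have tE : t = x + - a by rewrite xE addrK.
  rewrite {1}xE dprojE// tE dprojE//.
  by rewrite -sub0r submodB ?rpred0.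
have fK (x : submodT C) : g (f x) = x.
  by apply: val_inj; rewrite gE jE fE iE projK ?val_submodT//; exact: BA.
have gK (x : submodT B) : f (g x) = x.
  by apply: val_inj; rewrite fE iE gE jE projK ?val_submodT//; exact: CA.
by exists f => [|c]; [exists g | rewrite fE iE].
Qed.

(** * Conditions implying ADS *)

Lemma decomposition_of_sub S T C : decomposition S T -> trivial_meet C S ->
  {subset T <= submod_add S C} -> decomposition S C.
Proof.
move=> [_ ST] CS TSC; split=> [|x]; first exact: trivial_meetC.
have /submod_addP[s sS [t /TSC/submod_addP[s' s'S [c cC ->]] ->]] := ST x.
by rewrite addrA mem_submod_add// rpredD.
Qed.

(** The extension f need not map M into S, hence the detour through p; p o f
    is then an idempotent with image S and kernel the given complement. *)
Lemma extend_dproj_ADS :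
  (forall S1 S2, direct_summand S1 -> trivial_meet S1 S2 ->
     exists f : {linear M -> M}, {in submod_add S1 S2, f =1 dproj S1 S2}) ->
  ADS M.
Proof.
move=> ext S T C ST [CS Cmax]; have SC := trivial_meetC CS.
have [f fE] := ext S C (ex_intro _ T ST) SC.
have [p _ pE] := decomposition_proj ST.
have ST0 := ST.1.
have pS x : p x \in S.
  by rewrite pE; have /submod_addP[s sS [t tT ->]] := ST.2 x; rewrite dprojE.
have fC c : c \in C -> f c = 0.
  move=> cC; rewrite fE ?dproj_r//.
  by rewrite -[c]add0r mem_submod_add ?rpred0.
have fS s : s \in S -> f s = s.
  move=> sS; rewrite fE ?dproj_l//.
  by rewrite -[s]addr0 mem_submod_add ?rpred0.
have pfS s : s \in S -> p (f s) = s by move=> sS; rewrite fS// pE dproj_l.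
(* K is the kernel of p o f. *)
have [||K KE] := @submod_ex R M (fun x => p (f x) = 0).
- by rewrite !raddf0.
- by move=> a x y x0 y0; rewrite !linearP x0 y0 scaler0 addr0.
have KC x : p (f x) = 0 -> x \in C.
  move=> px0; apply: (Cmax K); last exact/KE.
    by move=> y /KE + yS; rewrite pfS.
  by move=> c cC; apply/KE; rewrite fC// raddf0.
split=> // x; rewrite -[x](subrK (p (f x))) addrC mem_submod_add//.
by apply: KC; rewrite !raddfB/= (pfS (p (f x)))// subrr.
Qed.

(** If a complement C of S missed t, the element t - g t could be added to it,
    where g extends the projection onto S along C to all of N. *)
Lemma relatively_injective_ADS :
  (forall S T t, decomposition S T -> t \in T ->
     exists2 N : submodClosed M, t \in N &
       relatively_injective (submodT S) (submodT N)) ->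
  ADS M.
Proof.
move=> inj S T C ST [CS Cmax]; have SC := trivial_meetC CS.
apply: (decomposition_of_sub ST CS) => t tT.
have [N tN {inj}Ninj] := inj _ _ _ ST tT.
(* The part of N on which the projection onto S along C is defined. *)
have [||X XE] := @submod_ex R (submodT N) (fun x => val x \in submod_add S C).
- by rewrite rpred0.
- by move=> a x y xX yX; rewrite linearP rpredD ?rpredZ.
have [|i iE] := @linear_ex R (submodT X) M (fun x => val (val x)).
  by move=> a x y; rewrite !linearP.
have iX x : i x \in submod_add S C by rewrite iE; apply/XE/val_submodT.
have [f fE] := dproj_ex SC iX.
have [g gE] := Ninj X f.
pose t' : submodT N := Sub t tN; pose u := t - val (g t').
suff uC : u \in C.
  by rewrite -[t](subrK (val (g t'))) addrC mem_submod_add// val_submodT.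
apply: (Cmax (submod_add C (cyclic_submod u))) => [y|c cC|].
- move=> /submod_addP[c cC [_ /asboolP[r ->] yE]] yS.
  have rtE : r *: t = (y + r *: val (g t')) + - c.
    by rewrite yE /u scalerBr addrA subrK addrAC subrr add0r.
  have cN : - c \in C by rewrite -sub0r submodB ?rpred0.
  have sS : y + r *: val (g t') \in S by rewrite rpredD ?rpredZ// val_submodT.
  have rtX : r *: t' \in X.
    by apply/XE; rewrite linearZ/= rtE mem_submod_add.
  (* By [rtE] the projection of r *: t is y + r *: g t, yet it is g (r *: t). *)
  have := congr1 val (gE (Sub (r *: t') rtX)).
  rewrite fE iE /= !linearZ/= rtE dprojE// => e.
  by apply: (addIr (r *: val (g t'))); rewrite add0r -e.
- by rewrite -[c]addr0 mem_submod_add ?rpred0.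
rewrite -[X in X \in _]add0r mem_submod_add ?rpred0//.
exact: cyclic_submod_gen.
Qed.

(** If t in T is the projection of c in C along S, then c - t lies in S, so
    surjectivity of the projection C -> T puts T inside S + C. *)
Lemma complement_iso_ADS :
  (forall A B C, decomposition A B -> complement A C ->
     exists2 f : {linear submodT C -> submodT B},
       bijective f & forall c, val (f c) = dproj B A (val c)) ->
  ADS M.
Proof.
move=> iso S T C ST cC; have [f [g _ gK] fE] := iso _ _ _ ST cC.
have [TS0 TS] := decompositionC ST; case: cC => CS _.
apply: (decomposition_of_sub ST CS) => t tT.
have /submod_addP[t' t'T [s sS cE]] := TS (val (g (Sub t tT))).
have := fE (g (Sub t tT)); rewrite gK cE dprojE//= => ->.
rewrite -[t'](addrK s) -cE addrC mem_submod_add ?val_submodT//.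
by rewrite -sub0r submodB ?rpred0.
Qed.

End ADS.

Theorem proposition3p2 (R : pzRingType) (M : lmodType R^c) :
  [<-> (* (i) *)
       ADS M;
       (* (ii), with endomorphisms *)
       forall S1 S2 : submodClosed M,
         direct_summand S1 -> trivial_meet S1 S2 ->
         (exists f : {linear M -> M},
            {in submod_add S1 S2, f =1 dproj S1 S2}) /\
         (exists f : {linear M -> M},
            {in submod_add S1 S2, f =1 dproj S2 S1});
       (* (ii), with idempotent endomorphisms *)
       forall S1 S2 : submodClosed M,
         direct_summand S1 -> trivial_meet S1 S2 ->
         (exists2 f : {linear M -> M},
            idempotent_fun f & {in submod_add S1 S2, f =1 dproj S1 S2}) /\
         (exists2 f : {linear M -> M},
            idempotent_fun f & {in submod_add S1 S2, f =1 dproj S2 S1});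
       (* (iii) *)
       forall M1 M2 : submodClosed M,
         decomposition M1 M2 -> mutually_injective (submodT M1) (submodT M2);
       (* (iv) *)
       forall A B C : submodClosed M,
         decomposition A B -> complement A C ->
         exists2 f : {linear submodT C -> submodT B},
           bijective f & forall c, val (f c) = dproj B A (val c);
       (* (v) *)
       forall (A B : submodClosed M) (b : M),
         decomposition A B -> b \in B ->
         relatively_injective (submodT A) (submodT (cyclic_submod b));
       (* (vi) *)
       forall (A : submodClosed M) (c : M),
         direct_summand A -> trivial_meet A (cyclic_submod c) ->
         relatively_injective (submodT A) (submodT (cyclic_submod c))].
Proof.
tfae.
- move=> ads S1 S2 dS S12.
  have [[f _ fE] [g _ gE]] := ADS_extend_dproj ads dS S12.
  by split; [exists f | exists g].
- move=> ext S1 S2; apply: ADS_extend_dproj.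
  by apply: extend_dproj_ADS => T1 T2 dT T12; case: (ext _ _ dT T12).
- move=> ext; have ads : ADS M.
    apply: extend_dproj_ADS => S1 S2 dS S12.
    by have [[f _ fE] _] := ext _ _ dS S12; exists f.
  move=> M1 M2 M12; have M21 := decompositionC M12.
  by split; apply: ADS_relatively_injective => //;
    [exists M2 | case: M12 | exists M1 | case: M21].
- move=> inj A B C; apply: ADS_complement_iso.
  apply: relatively_injective_ADS => S T t ST tT.
  by exists T => //; case: (inj _ _ ST).
- move=> iso A B b AB bB.
  apply: ADS_relatively_injective; first exact: complement_iso_ADS.
    by exists B.
  by move=> x xA /asboolP[r xE]; apply: AB.1 => //; rewrite xE rpredZ.
- move=> inj A c dA Ac; apply: ADS_relatively_injective => //.
  apply: relatively_injective_ADS => S T t ST tT.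
  exists (cyclic_submod t : submodClosed M).
    exact: cyclic_submod_gen.
  exact: inj ST tT.
- move=> inj; apply: relatively_injective_ADS => S T t ST tT.
  exists (cyclic_submod t : submodClosed M).
    exact: cyclic_submod_gen.
  apply: inj; first by exists T.
  by move=> x xS /asboolP[r xE]; apply: ST.1 => //; rewrite xE rpredZ.
Qed.
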